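(* Let $p>2$ be a prime. The sequence $\{S(\sigma_{n,3})\}_{n\geq 1}$ avoids $p$ if and only if $\operatorname{ord}_p(4)\equiv 2\pmod 4$, and likewise the sequence $\{S(\sigma_{n,[3,2]})\}_{n\geq 1}$ avoids $p$ if and only if $\operatorname{ord}_p(4)\equiv 2 \pmod 4$. In particular, both sequences avoid all primes of the form $8q+5$.
   Context: For $n\geq 1$, $$S(\sigma_{n,3})=\sum_{j=0}^n(-1)^{\binom{j}{3}}\binom{n}{j},\qquad S(\sigma_{n,[3,2]})=\sum_{j=0}^n(-1)^{\binom{j}{3}+\binom{j}{2}}\binom{n}{j}.$$ An integer sequence $\{x_n\}_{n\ge1}$ avoids a prime $p$ if $p\nmid x_n$ for every $n\geq 1$. $\operatorname{ord}_p(4)$ denotes the multiplicative order of $4$ modulo $p$. *)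

(* Defs.v *)
From mathcomp Require Import all_boot all_order all_fingroup all_algebra all_solvable.

Set Implicit Arguments.
Unset Strict Implicit.
Unset Printing Implicit Defensive.

Import GRing.Theory.
Local Open Scope ring_scope.

(* Exponential sums over F_2^n of the symmetric Boolean functions sigma_{n,3}
   and sigma_{n,3} + sigma_{n,2}, grouped by the Hamming weight j. *)
Definition S_sigma3 (n : nat) : int :=
  \sum_(0 <= j < n.+1) (-1) ^+ 'C(j, 3) * 'C(n, j)%:Z.

Definition S_sigma32 (n : nat) : int :=
  \sum_(0 <= j < n.+1) (-1) ^+ ('C(j, 3) + 'C(j, 2)) * 'C(n, j)%:Z.

(* Sequences are indexed by n >= 1; the value x 0 is irrelevant. *)
Definition avoids (x : nat -> int) (p : nat) : Prop :=
  forall n : nat, (0 < n)%N -> ~ (p%:Z %| x n)%Z.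

(* The order of a in the unit group of the prime field F_p. The default value 1
   of insubd is used only when p divides a. *)
Definition ord_mod (p a : nat) : nat :=
  #[insubd (1%g : {unit 'F_p}) (a%:R : 'F_p)]%g.

Lemma ord_modP (p a k : nat) : prime p -> coprime p a ->
  (ord_mod p a %| k)%N = (a ^ k == 1 %[mod p])%N.
Proof.
move=> p_pr co_pa.
have Ua : (a%:R : 'F_p) \is a GRing.unit by rewrite unitFpE.
rewrite /ord_mod order_dvdn -val_eqE FinRing.val_unitX FinRing.val_unit1.
rewrite val_insubd Ua -natrX -[1]/(1%:R) -val_eqE.
by rewrite [val _]val_Fp_nat // [val _]val_Fp_nat.
Qed.

(* Main.v *)
Require Import Defs.
From mathcomp Require Import all_boot all_order all_fingroup all_algebra.
From mathcomp Require Import zify ring.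

Set Implicit Arguments.
Unset Strict Implicit.
Unset Printing Implicit Defensive.

Import GRing.Theory.

(** The sign [(-1)^C(j,3)] has period 4 in [j], with values 1, 1, 1, -1; it is
    the indicator of the even numbers plus the imaginary part of [i^j].
    Likewise [(-1)^(C(j,3) + C(j,2))], with values 1, 1, -1, 1, is the indicator
    of the odd numbers plus the real part of [i^j].  By the binomial theorem,
    for [n >= 1] the two sums are therefore [2^(n-1) + Im (1+i)^n] and
    [2^(n-1) + Re (1+i)^n] ([S_sigma3E], [S_sigma32E]).

    Since [(1+i)^4 = -4], only [x = (-4)^m] with [m = (n-1) %/ 4] matters: up to
    a power of 2 the first sum is one of [x (x+1)], [x (2x+1)], [x^2], and the
    second is one of [x (x+1)], [x (2x-1)], [x^2].  If an odd prime [p] divides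
    [2x+1] or [2x-1], then [4 x^2 = 1] and so [(-4)^(2m+1) = -1] modulo [p].
    Hence either sequence avoids [p] iff -1 is not a power of -4 modulo [p]
    ([avoids_sigma3P], [avoids_sigma32P]).  This means that -4 has odd order,
    or equivalently that the order of 4 is twice an odd number
    ([order_mod4_eq2P]).

    If [p = 8q+5], reduce the first sum at [n = p] modulo [p]: only the terms
    [j = 0] and [j = p] survive and the sum is 2.  The formula above gives
    [x^2 + x] with [x = (-4)^(2q+1)], where [x^2 = 2^(p-1) = 1] by Fermat, so
    [x = 1].  Thus an odd power of -4 is 1, and -1 is not a power of -4
    ([expN4_neqN1_5mod8]). *)

(** * Sums weighted by a row of binomial coefficients *)

Section BinomialTransform.

Local Open Scope ring_scope.

Definition binsum (f : nat -> int) (n : nat) : int :=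
  \sum_(0 <= j < n.+1) f j * 'C(n, j)%:Z.

Lemma eq_binsum f g : f =1 g -> binsum f =1 binsum g.
Proof. by move=> eq_fg n; apply: eq_bigr => j _; rewrite eq_fg. Qed.

Lemma binsumD f g n : binsum (fun j => f j + g j) n = binsum f n + binsum g n.
Proof. by rewrite -big_split; apply: eq_bigr => j _; rewrite mulrDl. Qed.

Lemma binsumN f n : binsum (fun j => - f j) n = - binsum f n.
Proof. by rewrite -sumrN; apply: eq_bigr => j _; rewrite mulNr. Qed.

Lemma binsum0 f : binsum f 0 = f 0%N.
Proof. by rewrite /binsum big_nat1 bin0 mulr1. Qed.

(** Pascal's rule: [binsum f n] is the value at 0 of [(1 + E)^n f], where [E]
    is the shift operator on sequences. *)
Lemma binsumS f n : binsum f n.+1 = binsum f n + binsum (fun j => f j.+1) n.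
Proof.
have -> : binsum f n = \sum_(0 <= j < n.+2) f j * 'C(n, j)%:Z.
  by rewrite big_nat_recr //= bin_small // mulr0 addr0.
rewrite /binsum big_nat_recl // [in RHS]big_nat_recl // !bin0 -addrA.
rewrite -big_split /=; congr (_ + _); apply: eq_bigr => j _.
by rewrite binS PoszD mulrDr.
Qed.

Lemma binsum1 n : binsum (fun=> 1) n = 2 ^+ n.
Proof. by elim: n => [|n IHn]; rewrite ?binsum0 // binsumS IHn exprS; ring. Qed.

(** A parity class and its shift add up to the constant 1, so Pascal's rule
    reduces these sums to the full row sum. *)
Lemma binsum_even n : binsum (fun j => (~~ odd j)%:R) n.+1 = 2 ^+ n.
Proof.
rewrite binsumS -binsumD -binsum1; apply: eq_binsum => j /=.
by case: (odd j).
Qed.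

Lemma binsum_odd n : binsum (fun j => (odd j)%:R) n.+1 = 2 ^+ n.
Proof.
rewrite binsumS -binsumD -binsum1; apply: eq_binsum => j /=.
by case: (odd j).
Qed.

(** * Real and imaginary parts of the powers of 1 + i *)

(** The real and imaginary parts of [i^j]. *)
Definition re_i (j : nat) : int := (-1) ^+ odd j./2 * (~~ odd j)%:R.
Definition im_i (j : nat) : int := (-1) ^+ odd j./2 * (odd j)%:R.

Lemma odd_half_succ j : odd j.+1./2 = odd j (+) odd j./2.
Proof. by rewrite -[j.+1./2]/(uphalf j) uphalf_half oddD oddb. Qed.

Lemma re_iS j : re_i j.+1 = - im_i j.
Proof. by rewrite /re_i /im_i odd_half_succ /=; case: (odd j); case: odd. Qed.

Lemma im_iS j : im_i j.+1 = re_i j.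
Proof. by rewrite /re_i /im_i odd_half_succ /=; case: (odd j); case: odd. Qed.

Lemma binsum_reS n :
  binsum re_i n.+1 = binsum re_i n - binsum im_i n.
Proof. by rewrite binsumS (eq_binsum re_iS) binsumN. Qed.

Lemma binsum_imS n :
  binsum im_i n.+1 = binsum im_i n + binsum re_i n.
Proof. by rewrite binsumS (eq_binsum im_iS). Qed.

(** The sums of [i^j C(n, j)] are the powers [(1 + i)^n], and
    [(1 + i)^4 = -4]. *)
Lemma binsum_i_mul4 m :
  binsum re_i (4 * m) = (-4) ^+ m /\ binsum im_i (4 * m) = 0.
Proof.
elim: m => [|m [IHre IHim]]; first by rewrite !binsum0.
rewrite mulnS !(binsum_reS, binsum_imS) IHre IHim exprS.
by split; ring.
Qed.

(** * Closed forms of the two exponential sums *)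

Lemma odd_bin2 j : odd 'C(j, 2) = odd j./2.
Proof. by elim: j => // j IHj; rewrite binS oddD IHj bin1 odd_half_succ addbC. Qed.

Lemma odd_bin3 j : odd 'C(j, 3) = odd j && odd j./2.
Proof.
elim: j => // j IHj; rewrite binS oddD IHj odd_bin2 odd_half_succ /=.
by case: (odd j); case: odd.
Qed.

(** The sign is the indicator of the even [j] plus [im_i j]. *)
Lemma S_sigma3E n : S_sigma3 n.+1 = 2 ^+ n + binsum im_i n.+1.
Proof.
rewrite -binsum_even -binsumD; apply: eq_bigr => j _; congr (_ * _).
by rewrite -signr_odd odd_bin3 /im_i; case: (odd j); case: odd.
Qed.

(** The sign is the indicator of the odd [j] plus [re_i j]. *)
Lemma S_sigma32E n : S_sigma32 n.+1 = 2 ^+ n + binsum re_i n.+1.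
Proof.
rewrite -binsum_odd -binsumD; apply: eq_bigr => j _; congr (_ * _).
rewrite -signr_odd oddD odd_bin3 odd_bin2 /re_i.
by case: (odd j); case: odd.
Qed.

Lemma expr2_mul4 m : 2 ^+ (4 * m) = ((-4) ^+ m) ^+ 2 :> int.
Proof. by rewrite exprM [RHS]exprAC. Qed.

Lemma S_sigma3_values m (x := (-4) ^+ m : int) :
  [/\ S_sigma3 (4 * m).+1 = x * (x + 1),
      S_sigma3 (4 * m).+2 = 2 * x * (x + 1),
      S_sigma3 (4 * m).+3 = 2 * x * (2 * x + 1)
    & S_sigma3 (4 * m).+4 = 8 * x ^+ 2].
Proof.
have [re_m im_m] := binsum_i_mul4 m.
rewrite !S_sigma3E !(binsum_reS, binsum_imS) re_m im_m.
by rewrite !(exprS 2) expr2_mul4 -/x; split; ring.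
Qed.

Lemma S_sigma32_values m (x := (-4) ^+ m : int) :
  [/\ S_sigma32 (4 * m).+1 = x * (x + 1),
      S_sigma32 (4 * m).+2 = 2 * x ^+ 2,
      S_sigma32 (4 * m).+3 = 2 * x * (2 * x - 1)
    & S_sigma32 (4 * m).+4 = 4 * x * (2 * x - 1)].
Proof.
have [re_m im_m] := binsum_i_mul4 m.
rewrite !S_sigma32E !(binsum_reS, binsum_imS) re_m im_m.
by rewrite !(exprS 2) expr2_mul4 -/x; split; ring.
Qed.

End BinomialTransform.

(** * Avoidance as a condition on the powers of -4 *)

Section Avoidance.

Local Open Scope ring_scope.

Variable p : nat.
Hypotheses (p_pr : prime p) (p_gt2 : (2 < p)%N).

Lemma dvdz_FpE (z : int) : (p%:Z %| z)%Z = (z%:~R == 0 :> 'F_p).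
Proof. by rewrite (dvdz_pcharf (pchar_Fp p_pr)). Qed.

Lemma Fp_two_neq0 : (2 : 'F_p) != 0.
Proof.
rewrite -(dvdn_pcharf (pchar_Fp p_pr)); apply/negP=> /(@dvdn_leq _ 2 isT).
by rewrite leqNgt p_gt2.
Qed.

Lemma Fp_four_neq0 : (4 : 'F_p) != 0.
Proof.
by rewrite (_ : 4 = 2 * 2); [rewrite mulf_neq0 ?Fp_two_neq0 | ring].
Qed.

Lemma Fp_expN4_neq0 m : (-4 : 'F_p) ^+ m != 0.
Proof. by rewrite expf_neq0 // oppr_eq0 Fp_four_neq0. Qed.

(** If [2x = 1] or [2x = -1] with [x = (-4)^m], then [(-4)^(2m+1)] equals
    [- (2x)^2 = -1]. *)
Lemma expN4_double_neq (e : 'F_p) m :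
    (forall k, (-4 : 'F_p) ^+ k != -1) -> e ^+ 2 = 1 ->
  2 * (-4) ^+ m + e != 0.
Proof.
move=> noN1 e2; apply: contra (noN1 (2 * m).+1) => /eqP def_e.
have def_2x : 2 * (-4) ^+ m = - e by apply/eqP; rewrite -addr_eq0 def_e.
rewrite exprS mulnC exprM; set y := (-4) ^+ m in def_2x *.
by rewrite (_ : -4 * y ^+ 2 = - (2 * y) ^+ 2); [rewrite def_2x sqrrN e2 | ring].
Qed.

(** The closed forms are uniform in [m = (n-1) %/ 4] once the residue of [n-1]
    modulo 4 is fixed. *)
Lemma avoids_by4 (x : nat -> int) :
  avoids x p <->
  forall m, [/\ (x (4 * m).+1)%:~R != 0 :> 'F_p, (x (4 * m).+2)%:~R != 0 :> 'F_p,
                (x (4 * m).+3)%:~R != 0 :> 'F_p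
              & (x (4 * m).+4)%:~R != 0 :> 'F_p].
Proof.
split=> [avx m | xN0 n n_gt0].
  by split; rewrite -dvdz_FpE; apply/negP; apply: avx.
have def_n : n = (4 * (n.-1 %/ 4) + n.-1 %% 4).+1 by lia.
rewrite dvdz_FpE; apply/negP; rewrite {}def_n.
have : (n.-1 %% 4 < 4)%N by rewrite ltn_mod.
move: (n.-1 %% 4)%N (xN0 (n.-1 %/ 4)%N) => r [x1 x2 x3 x4].
by case: r => [|[|[|[|//]]]]; rewrite ?(addn0, addn1, addn2, addn3).
Qed.

Lemma intr_expN4 m : ((-4 : int) ^+ m)%:~R = (-4) ^+ m :> 'F_p.
Proof. by rewrite rmorphXn rmorphN rmorph_nat. Qed.

Let Fp_closedE := (rmorph_nat, rmorph1, rmorphM, rmorphB, rmorphD).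

Lemma avoids_sigma3P :
  avoids S_sigma3 p <-> forall m, (-4 : 'F_p) ^+ m != -1.
Proof.
rewrite avoids_by4; split=> [xN0 m | noN1 m].
  have [+ _ _ _] := xN0 m; have [-> _ _ _] := S_sigma3_values m.
  apply: contra => /eqP xN1.
  by rewrite !Fp_closedE /= intr_expN4 xN1 addNr mulr0.
have [-> -> -> ->] := S_sigma3_values m; rewrite expr2 !Fp_closedE /= intr_expN4.
have x_neq0 := Fp_expN4_neq0 m; have x1_neq0 := noN1 m.
rewrite -addr_eq0 in x1_neq0.
have two_x1_neq0 := expN4_double_neq m noN1 (expr1n _ 2).
have two_neq0 := Fp_two_neq0.
have eight_neq0 : (8 : 'F_p) != 0.
  by rewrite (_ : 8 = 2 ^+ 3) ?expf_neq0 //; ring.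
by split; rewrite ?mulf_neq0.
Qed.

Lemma avoids_sigma32P :
  avoids S_sigma32 p <-> forall m, (-4 : 'F_p) ^+ m != -1.
Proof.
rewrite avoids_by4; split=> [xN0 m | noN1 m].
  have [+ _ _ _] := xN0 m; have [-> _ _ _] := S_sigma32_values m.
  apply: contra => /eqP xN1.
  by rewrite !Fp_closedE /= intr_expN4 xN1 addNr mulr0.
have [-> -> -> ->] := S_sigma32_values m; rewrite expr2 !Fp_closedE /= intr_expN4.
have x_neq0 := Fp_expN4_neq0 m; have x1_neq0 := noN1 m.
rewrite -addr_eq0 in x1_neq0.
have e2 : (-1 : 'F_p) ^+ 2 = 1 by rewrite sqrrN expr1n.
have two_x1_neq0 := expN4_double_neq m noN1 e2.
have [two_neq0 four_neq0] := (Fp_two_neq0, Fp_four_neq0).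
by split; rewrite ?mulf_neq0.
Qed.

Lemma ord_mod4_dvdP k : (ord_mod p 4 %| k)%N = ((4 : 'F_p) ^+ k == 1).
Proof.
rewrite ord_modP // ?prime_coprime //; last first.
  by rewrite (dvdn_pcharf (pchar_Fp p_pr)) Fp_four_neq0.
by rewrite -[4 : 'F_p]/(4%:R) -natrX -[1 : 'F_p]/(1%:R) -!val_Fp_nat.
Qed.

(** Raising [(-4)^m = -1] to the odd power [k] would give [1 = -1]. *)
Lemma expN4_neqN1_odd k :
  odd k -> (-4 : 'F_p) ^+ k = 1 -> forall m, (-4 : 'F_p) ^+ m != -1.
Proof.
move=> k_odd N4k m; apply: contra Fp_two_neq0 => /eqP xN1.
have := congr1 (fun y => y ^+ k) xN1.
rewrite exprAC N4k expr1n -signr_odd k_odd => /eqP.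
by rewrite -addr_eq0.
Qed.

(** Write [d] for the order of 4.  If [d] is odd then [(-4)^d = -1]; if [d = 4k]
    then [4^(2k)] is a square root of 1 other than 1, so [(-4)^(2k) = -1].
    If [d = 2h] with [h] odd, then [4^h = -1], so [(-4)^h = 1], which
    excludes -1 from the powers of -4. *)
Lemma order_mod4_eq2P :
  (forall m, (-4 : 'F_p) ^+ m != -1) <-> ord_mod p 4 = 2 %[mod 4].
Proof.
have d_gt0 : (0 < ord_mod p 4)%N by exact: order_gt0.
move: (ord_mod p 4) d_gt0 ord_mod4_dvdP => d d_gt0 dvd_d.
have half_order h : d = (2 * h)%N -> (4 : 'F_p) ^+ h = -1.
  move=> def_d; have : (4 : 'F_p) ^+ h ^+ 2 == 1.
    by rewrite -exprM mulnC -def_d -dvd_d.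
  rewrite sqrf_eq1 -dvd_d => /orP[/dvdn_leq | /eqP //].
  by lia.
split=> [noN1 | d_mod4].
  have [d_odd | d_even] := boolP (odd d).
    case/eqP: (noN1 d); rewrite exprNn -signr_odd d_odd mulN1r.
    by congr (- _); apply/eqP; rewrite -dvd_d.
  have [d_mod4 | //] := eqVneq (d %% 4)%N 0%N; last by lia.
  case/eqP: (noN1 (2 * (d %/ 4))%N).
  rewrite exprNn -signr_odd oddM mul1r; apply: half_order; lia.
have [h def_d h_odd] : exists2 h, d = (2 * h)%N & odd h.
  by exists (d %/ 2)%N; lia.
apply: (expN4_neqN1_odd h_odd).
by rewrite exprNn half_order // -signr_odd h_odd mulrNN mulr1.
Qed.

End Avoidance.

(** * Primes of the form 8q + 5 *)

(** [p] divides [C(p, j)] for [0 < j < p], so only the two extreme terms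
    survive modulo [p]. *)
Lemma binsum_prime (p : nat) (f : nat -> int) : prime p ->
  (p%:Z %| binsum f p - (f 0%N + f p))%Z%R.
Proof.
move=> p_pr; have p_gt0 := prime_gt0 p_pr.
rewrite /binsum big_nat_recr //= big_ltn // bin0 binn !mulr1.
rewrite (addrAC (f 0%N)) (addrC (f 0%N + f p)%R) addrK.
rewrite big_nat; apply: rpred_sum => j /andP[j_gt0 lt_jp].
by apply: dvdz_mull; rewrite dvdzE prime_dvd_bin // j_gt0.
Qed.

(** With [x = (-4)^(2q+1)], computing [S_sigma3 p] modulo [p] in two ways gives
    [x^2 + x = 2], and Fermat gives [x^2 = 1]; hence [x = 1], an odd power
    of -4. *)
Lemma expN4_neqN1_5mod8 (p q : nat) : prime p -> p = 8 * q + 5 ->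
  (forall m, (-4 : 'F_p) ^+ m != -1)%R.
Proof.
move=> p_pr def_p; have p_gt2 : 2 < p by lia.
pose k := (2 * q).+1; pose x : 'F_p := ((-4) ^+ k)%R.
have def_p4 : p = (4 * k).+1 by lia.
(* The closed form gives [x (x + 1)]; both surviving signs are 1, as
     [p./2 = 4q + 2] is even. *)
have sum_p : (x * (x + 1) = 2)%R.
  have [S_p _ _ _] := S_sigma3_values k; rewrite -def_p4 in S_p.
  have := binsum_prime (fun j => (-1) ^+ 'C(j, 3))%R p_pr.
  rewrite -[binsum _ p]/(S_sigma3 p) S_p dvdz_FpE //.
  rewrite -(signr_odd _ 'C(p, 3)) odd_bin3.
  rewrite (_ : odd p && odd p./2 = false); last by lia.
  rewrite -[(_ ^+ 'C(0, 3) + _ ^+ false)%R]/(2%:R)%R rmorphB rmorphM rmorphD /=.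
  by rewrite intr_expN4 rmorph_nat rmorph1 subr_eq0 => /eqP.
have fermat : (2 * x ^+ 2 = 2)%R.
  rewrite -[RHS](pFrobenius_aut_nat (pchar_Fp p_pr)) pFrobenius_autE.
  rewrite [X in _ = (_ ^+ X)%R]def_p4 [RHS]exprS exprM.
  by congr (_ * _)%R; rewrite [LHS]exprAC; congr (_ ^+ _)%R; ring.
have x1 : x = 1%R.
  apply: (mulfI (Fp_two_neq0 p_pr p_gt2)); apply: (addrI (2 * x ^+ 2)%R).
  have -> : (2 * x ^+ 2 + 2 * x = 2 * (x * (x + 1)))%R by ring.
  by rewrite sum_p fermat; ring.
by apply: expN4_neqN1_odd x1; rewrite //= oddM.
Qed.

Theorem theorem5p8 :
  (forall p : nat, prime p -> 2 < p ->
     (avoids S_sigma3 p <-> ord_mod p 4 = 2 %[mod 4]) /\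
     (avoids S_sigma32 p <-> ord_mod p 4 = 2 %[mod 4])) /\
  (forall p q : nat, prime p -> p = 8 * q + 5 ->
     avoids S_sigma3 p /\ avoids S_sigma32 p).
Proof.
split=> [p p_pr p_gt2 | p q p_pr def_p].
  by split; rewrite (avoids_sigma3P, avoids_sigma32P) // order_mod4_eq2P.
have p_gt2 : 2 < p by lia.
have noN1 := expN4_neqN1_5mod8 p_pr def_p.
by rewrite avoids_sigma3P // avoids_sigma32P.
Qed.
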